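(* Let $q\equiv 3\pmod 4$ be a prime power. A map $\psi:\mathbb{F}_q^4\to\mathbb{F}_q^4$ satisfies, for all $\mathbf{r}_1,\mathbf{r}_2\in\mathbb{F}_q^4$, $$(\mathbf{r}_1-\mathbf{r}_2,\mathbf{r}_1-\mathbf{r}_2)=0,\ \mathbf{r}_1\neq\mathbf{r}_2\ \Longrightarrow\ \big(\psi(\mathbf{r}_1)-\psi(\mathbf{r}_2),\psi(\mathbf{r}_1)-\psi(\mathbf{r}_2)\big)=0,\ \psi(\mathbf{r}_1)\neq\psi(\mathbf{r}_2),$$ if and only if it is of the form $\psi(\mathbf{r})=\alpha L\mathbf{r}^\tau+\mathbf{r}_0$ for all $\mathbf{r}$, or $\psi(\mathbf{r})=\alpha K\mathbf{r}^\tau+\mathbf{r}_0$ for all $\mathbf{r}$, where $0\neq\alpha\in\mathbb{F}_q$ and $\mathbf{r}_0\in\mathbb{F}_q^4$ are fixed, $\tau$ is an automorphism of $\mathbb{F}_q$ applied coordinate-wise, and $L$ and $K$ are a Lorentz and an anti-Lorentz matrix respectively.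
   Context: For $\mathbf{r}_k=(x_k,y_k,z_k,t_k)^\top\in\mathbb{F}_q^4$ put $(\mathbf{r}_1,\mathbf{r}_2)=-x_1x_2-y_1y_2-z_1z_2+t_1t_2$. A $4\times4$ matrix $L$ over $\mathbb{F}_q$ is Lorentz if $(L\mathbf{r}_1,L\mathbf{r}_2)=(\mathbf{r}_1,\mathbf{r}_2)$ for all $\mathbf{r}_1,\mathbf{r}_2\in\mathbb{F}_q^4$, and anti-Lorentz if $(K\mathbf{r}_1,K\mathbf{r}_2)=-(\mathbf{r}_1,\mathbf{r}_2)$ for all $\mathbf{r}_1,\mathbf{r}_2$. *)

(* Defs.v *)
From HB Require Import structures.
From mathcomp Require Import all_boot all_order all_algebra all_field.
Set Implicit Arguments. Unset Strict Implicit. Unset Printing Implicit Defensive.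
Import GRing.Theory.
Local Open Scope ring_scope.

(* Points of F_q^4 are column vectors r = (x, y, z, t)^T, indices 0,1,2,3. *)
Definition mink (F : fieldType) (r1 r2 : 'cV[F]_4) : F :=
  \sum_(i < 4) (if (i : nat) == 3%N then 1 else -1) * r1 i 0 * r2 i 0.

Definition lorentz (F : fieldType) (L : 'M[F]_4) : Prop :=
  forall r1 r2 : 'cV[F]_4, mink (L *m r1) (L *m r2) = mink r1 r2.

Definition antilorentz (F : fieldType) (K : 'M[F]_4) : Prop :=
  forall r1 r2 : 'cV[F]_4, mink (K *m r1) (K *m r2) = - mink r1 r2.

(* Main.v *)
Require Import Defs.
From HB Require Import structures.
From mathcomp Require Import all_boot all_order all_algebra all_field.
From mathcomp Require Import ring zify.
Set Implicit Arguments. Unset Strict Implicit. Unset Printing Implicit Defensive.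
Import Order.TTheory GRing.Theory Num.Theory.
Local Open Scope ring_scope.

(** Since -1 is not a square, the form has Witt index 1: the maximal cliques of
    the nullity graph are the null lines, so [psi] maps null lines bijectively
    to null lines.  Two parallel null lines that differ by a null vector are
    perfectly matched by null vectors, whereas two null lines of different
    directions have no perfect matching; hence [psi] induces a map on null
    directions.

    That map is injective.  If two directions u, v had the same image but some w
    did not, then [psi] would be constant along every vector a u + b v with
    a, b <> 0, which is absurd.  If all directions had the same image, [psi]
    would be a proper colouring of the graph with q colours, which a
    second-moment count between the two slices t - x = 0 and t - x = 1 excludes.

    For null u, v of different directions, the displacement of [psi] along v is
    then unchanged under translation by u.  As null vectors generate the space,
    [psi] is additive up to translation.  An additive null-preserving map [phi]
    satisfies [(phi (a ea), phi (b eb)) = - (phi z, phi z) / 2] whenever z is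
    orthogonal to the hyperbolic pair ea, eb and a ea + b eb + z is null; so this
    value depends on the product a b alone, and the field automorphism appears. *)

(** * Squares in a field whose order is 3 modulo 4 *)

Section SumsOfTwoSquares.
Variables (F : finFieldType) (hq : (#|F| %% 4 = 3)%N).

Lemma card_3mod4 : exists m, #|F| = (m * 4 + 3)%N.
Proof. by exists (#|F| %/ 4)%N; rewrite {1}(divn_eq #|F| 4) hq. Qed.

Lemma natr_card0 : #|F|%:R = 0 :> F.
Proof.
have : \sum_(x : F) x = \sum_(x : F) (x + 1).
  by rewrite [LHS](reindex_inj (addIr 1)).
rewrite big_split /= sumr_const => /(congr1 (fun y => y - \sum_(x : F) x)).
by rewrite subrr addrAC subrr add0r => ->.
Qed.

Lemma two_neq0 : 2 != 0 :> F.
Proof.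
apply/eqP=> two0; have := natr_card0; have [m ->] := card_3mod4.
have -> : (m * 4 + 3)%:R = m%:R * 2 * 2 + 2 + 1 :> F by ring.
by rewrite two0 !mulr0 !add0r => /eqP; rewrite oner_eq0.
Qed.

(** If i^2 = -1 and q = 4m + 3, then i^q = i^3 = -i, whereas i^q = i in a field of order q. *)
Lemma sqr_neqN1 (i : F) : i ^+ 2 != -1.
Proof.
apply/eqP=> i2; have [m cF] := card_3mod4.
have := expf_card i; rewrite cF exprD mulnC exprM.
rewrite (_ : i ^+ 4 = 1); last by rewrite (exprM i 2 2) i2 sqrrN expr1n.
rewrite expr1n mul1r exprS i2 mulrN1 => /eqP.
rewrite -subr_eq0 -opprD oppr_eq0 -mulr2n -mulr_natl mulf_eq0 (negPf two_neq0) /=.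
by move/eqP=> i0; move/eqP: i2; rewrite i0 expr0n eq_sym oppr_eq0 oner_eq0.
Qed.

Lemma sum_sqr_eq0 (x y : F) : x ^+ 2 + y ^+ 2 = 0 -> x = 0 /\ y = 0.
Proof.
have [->|y0] := eqVneq y 0; first by rewrite expr0n addr0 => /eqP; rewrite sqrf_eq0 => /eqP.
move=> /eqP; rewrite addr_eq0 => /eqP xy; have /eqP[] := sqr_neqN1 (x / y).
by rewrite expr_div_n xy mulNr divff // sqrf_eq0.
Qed.

(** For c nonzero and q = 4m + 3, the power c^(2m+1) is 1 or -1, and c times it is the square of
    c^(m+1). *)
Lemma sqr_or_Nsqr (c : F) : exists s : F, c = s ^+ 2 \/ c = - s ^+ 2.
Proof.
have [->|c0] := eqVneq c 0; first by exists 0; left; rewrite expr0n.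
have [m cF] := card_3mod4; exists (c ^+ m.+1).
have : (c ^+ (m * 2).+1) ^+ 2 = 1.
  apply: (mulIf c0); rewrite -exprM -exprSr mul1r -[RHS](expf_card c) cF.
  congr (_ ^+ _); lia.
have cE : (c ^+ m.+1) ^+ 2 = c * c ^+ (m * 2).+1.
  by rewrite -exprM -exprS; congr (_ ^+ _); lia.
rewrite cE; move/eqP; rewrite sqrf_eq1 => /orP[]/eqP->; [left|right]; ring.
Qed.

(** The squares are not closed under adding 1: otherwise every natural number, in particular q - 1 =
    -1, would be one. So some x^2 + 1 equals -s^2, and scaling by t / s settles c = -t^2. *)
Lemma sum_two_squares (c : F) : exists y z : F, y ^+ 2 + z ^+ 2 = c.
Proof.
have [x [s xs]] : exists x s : F, x ^+ 2 + 1 = - s ^+ 2.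
  have [/forallP sqS|] := boolP [forall x : F, exists s, x ^+ 2 + 1 == s ^+ 2].
    have sqn n : exists s : F, n%:R = s ^+ 2.
      elim: n => [|n [s sn]]; first by exists 0; rewrite expr0n.
      by have /existsP[t /eqP te] := sqS s; exists t; rewrite -te -natr1 sn.
    have [s sE] := sqn #|F|.-1; exfalso; have /eqP[] := sqr_neqN1 s.
    apply/eqP; rewrite -sE -addr_eq0 natr1 prednK ?natr_card0 //.
    by apply/card_gt0P; exists 0.
  case/forallPn=> x /existsPn nsq; exists x.
  have [s [/eqP e|e]] := sqr_or_Nsqr (x ^+ 2 + 1); last by exists s.
  by have /negP[] := nsq s.
have s0 : s != 0.
  apply/eqP=> s0; have [] := @sum_sqr_eq0 x 1; last by move=> _ /eqP; rewrite oner_eq0.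
  by rewrite expr1n xs s0 expr0n oppr0.
have [t [->|->]] := sqr_or_Nsqr c; first by exists t, 0; ring.
exists (t * x / s), (t / s).
have -> : (t * x / s) ^+ 2 + (t / s) ^+ 2 = t ^+ 2 * (x ^+ 2 + 1) / s ^+ 2 by field.
by rewrite xs; field.
Qed.
End SumsOfTwoSquares.

(** * Second-moment count between two parallel slices *)

Section Slices.
Variable F : finFieldType.
Hypothesis two0 : 2 != 0 :> F.

Lemma sum_indicator (c : F) : \sum_(b : F) (b == c)%:R = 1 :> int.
Proof. by rewrite (bigD1 c) //= eqxx big1 ?addr0 // => b /negPf ->. Qed.

Lemma sum_indicator_line (a b c : F) : (a != 0) || (b != 0) ->
  \sum_(y : F * F) (a * y.1 + b * y.2 == c)%:R = #|F|%:R :> int.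
Proof.
rewrite -(pair_bigA _ (fun y z => (a * y + b * z == c)%:R)) /=.
case/orP=> [a0|b0].
  rewrite exchange_big /= (eq_bigr (fun=> 1)) ?sumr_const // => z _.
  rewrite -[RHS](sum_indicator ((c - b * z) / a)).
  apply: eq_bigr => y _; congr (_%:R); congr (nat_of_bool _).
  by rewrite -[RHS](inj_eq (mulfI a0)) mulrCA divff // mulr1 eq_sym [RHS]eq_sym subr_eq.
rewrite (eq_bigr (fun=> 1)) ?sumr_const // => y _.
rewrite -[RHS](sum_indicator ((c - a * y) / b)).
apply: eq_bigr => z _; congr (_%:R); congr (nat_of_bool _).
by rewrite -[RHS](inj_eq (mulfI b0)) mulrCA divff // mulr1 eq_sym [RHS]eq_sym subr_eq addrC.
Qed.

Let dist2 (p y : F * F) := (y.1 - p.1) ^+ 2 + (y.2 - p.2) ^+ 2.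

(** [g0] and [g1] will locate one colour class in the slices t - x = 0 and t - x = 1; the equation
    says that two of its points differ by a null vector. If it never held, [n y (g1 y)] would vanish
    for all y, so the squared deviations of [n] from its mean q would sum to at least q^4; the
    moments give q^4 - q^3. *)
Lemma exists_null_between_slices (g0 g1 : F * F -> F) :
  exists p y, g1 y - g0 p = dist2 p y.
Proof.
have [/existsP[p /existsP[y /eqP e]]|/existsPn none] :=
  boolP [exists p, exists y, g1 y - g0 p == dist2 p y]; first by exists p, y.
exfalso.
pose q : int := #|F|%:R.
pose n y b : int := \sum_p (b == g0 p + dist2 p y)%:R.
have sumn : \sum_y \sum_b n y b = q ^+ 4.
  rewrite (eq_bigr (fun=> q ^+ 2)) => [|y _].
    by rewrite sumr_const card_prod -mulr_natr natrM /q; ring.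
  rewrite exchange_big /= (eq_bigr (fun=> 1)) => [|p _]; last exact: sum_indicator.
  by rewrite sumr_const card_prod natrM.
have sumn2 : \sum_y \sum_b n y b ^+ 2 = q ^+ 4 + q ^+ 5 - q ^+ 3.
  transitivity (\sum_(p : F * F) \sum_(p' : F * F) \sum_(y : F * F)
      (g0 p + dist2 p y == g0 p' + dist2 p' y)%:R : int).
    under [RHS]eq_bigr do rewrite exchange_big /=.
    rewrite [RHS]exchange_big /=; apply: eq_bigr => y _.
    under eq_bigr do rewrite expr2 /n mulr_suml.
    rewrite exchange_big /=; apply: eq_bigr => p _.
    under eq_bigr do rewrite mulr_sumr.
    rewrite exchange_big /=; apply: eq_bigr => p' _.
    rewrite (bigD1 (g0 p + dist2 p y)) //= eqxx mul1r big1 ?addr0 // => b.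
    by move/negPf->; rewrite mul0r.
  (* The quadratic terms in y cancel, which leaves the equation of a line. *)
  have sum1 (p p' : F * F) : p' != p -> \sum_(y : F * F)
      (g0 p + dist2 p y == g0 p' + dist2 p' y)%:R = q.
    move=> pp'; pose c := g0 p' + p'.1 ^+ 2 + p'.2 ^+ 2 - (g0 p + p.1 ^+ 2 + p.2 ^+ 2).
    rewrite /q -(@sum_indicator_line (2 * (p'.1 - p.1)) (2 * (p'.2 - p.2)) c).
      apply: eq_bigr => y _; congr (_%:R); congr (nat_of_bool _).
      rewrite -subr_eq0 -[in RHS]subr_eq0; congr (_ == _).
      by rewrite /c /dist2; ring.
    rewrite !mulf_eq0 (negPf two0) /= !subr_eq0; move: pp'.
    by case: p p' {c} => [a b] [a' b'] /=; rewrite xpair_eqE negb_and.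
  have sum2 (p : F * F) : \sum_(p' : F * F) \sum_(y : F * F)
      (g0 p + dist2 p y == g0 p' + dist2 p' y)%:R = q ^+ 2 + (q ^+ 2 - 1) * q.
    rewrite (bigD1 p) //=; congr (_ + _).
      rewrite (eq_bigr (fun=> 1)) => [|y _]; last by rewrite eqxx.
      by rewrite sumr_const card_prod natrM.
    rewrite (eq_bigr (fun=> q)) => [|p' pp']; last exact: sum1.
    rewrite sumr_const -mulr_natl; congr (_ * _).
    have := cardC (pred1 p); rewrite card1 card_prod => cardE.
    have -> : #|fun i : F * F => i != p| = (#|F| * #|F| - 1)%N.
      by rewrite -cardE addKn; apply: eq_card.
    rewrite natrB ?natrM -?expr2 //.
    by rewrite muln_gt0 andbb; apply/card_gt0P; exists 0.
  rewrite (eq_bigr (fun=> q ^+ 2 + (q ^+ 2 - 1) * q)) // sumr_const card_prod.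
  by rewrite -mulr_natl natrM -/q; ring.
have n0 y : n y (g1 y) = 0.
  rewrite /n big1 // => p _; have /existsPn/(_ y) := none p.
  by rewrite subr_eq addrC => /negPf ->.
have le1 y : q ^+ 2 <= \sum_b (n y b - q) ^+ 2.
  rewrite (bigD1 (g1 y)) //= n0 sub0r sqrrN lerDl; apply: sumr_ge0 => b _.
  exact: sqr_ge0.
have : \sum_(y : F * F) q ^+ 2 <= \sum_y \sum_b (n y b - q) ^+ 2 by apply: ler_sum.
have -> : \sum_y \sum_b (n y b - q) ^+ 2 = q ^+ 4 - q ^+ 3.
  have -> : q ^+ 4 - q ^+ 3 = \sum_y \sum_b n y b ^+ 2
      + (- 2 * q * \sum_y \sum_b n y b + \sum_(y : F * F) \sum_(b : F) q ^+ 2).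
    rewrite sumn sumn2 !sumr_const card_prod -!mulrnA -[_ *+ (_ * _)]mulr_natl !natrM -/q.
    by ring.
  rewrite mulr_sumr -!big_split /=; apply: eq_bigr => y _.
  rewrite mulr_sumr -!big_split /=; apply: eq_bigr => b _.
  by ring.
rewrite sumr_const card_prod -mulr_natl natrM -/q.
have q0 : 0 < q by rewrite ltr0n; apply/card_gt0P; exists 0.
rewrite -subr_ge0 (_ : _ - _ = - q ^+ 3); last by ring.
by rewrite oppr_ge0 leNgt exprn_gt0.
Qed.
End Slices.

(** * Bilinear algebra of the form in light-cone coordinates *)

Section MinkowskiForm.
Variable F : fieldType.
Implicit Types (x y z u v w : 'cV[F]_4) (c s : F).

Lemma minkC x y : mink x y = mink y x.
Proof. by apply: eq_bigr => i _; ring. Qed.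
Lemma minkDl x y z : mink (x + y) z = mink x z + mink y z.
Proof. by rewrite -big_split /=; apply: eq_bigr => i _; rewrite !mxE; case: ifP => _; ring. Qed.
Lemma minkZl c x y : mink (c *: x) y = c * mink x y.
Proof. by rewrite mulr_sumr; apply: eq_bigr => i _; rewrite !mxE; case: ifP => _; ring. Qed.
Lemma minkDr x y z : mink z (x + y) = mink z x + mink z y.
Proof. by rewrite !(minkC z) minkDl. Qed.
Lemma minkZr c x y : mink x (c *: y) = c * mink x y.
Proof. by rewrite minkC minkZl minkC. Qed.
Lemma minkNl x y : mink (- x) y = - mink x y.
Proof. by rewrite -scaleN1r minkZl mulN1r. Qed.
Lemma minkNr x y : mink x (- y) = - mink x y.
Proof. by rewrite minkC minkNl minkC. Qed.
Lemma mink0l x : mink 0 x = 0.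
Proof. by rewrite -(scale0r x) minkZl mul0r. Qed.
Lemma mink0r x : mink x 0 = 0.
Proof. by rewrite minkC mink0l. Qed.
Definition mink_lin := (minkDl, minkDr, minkZl, minkZr, minkNl, minkNr, mink0l, mink0r).

Lemma minkDD x y : mink (x + y) (x + y) = mink x x + 2 * mink x y + mink y y.
Proof. by rewrite !mink_lin (minkC y x); ring. Qed.
Lemma minkBB x y : mink (x - y) (x - y) = mink x x - 2 * mink x y + mink y y.
Proof. by rewrite !mink_lin (minkC y x); ring. Qed.

(* Light-cone coordinates: a = t - x and b = t + x. *)
Definition lc (a b y z : F) : 'cV[F]_4 :=
  \col_(i < 4) [:: (b - a) / 2; y; z; (a + b) / 2]`_i.

Hypothesis two0 : 2 != 0 :> F.

Lemma lcP x : exists a b y z : F, x = lc a b y z.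
Proof.
pose e k : F := x (inord k) 0.
exists (e 3%N - e 0%N), (e 3%N + e 0%N), (e 1%N), (e 2%N).
apply/colP=> i; rewrite !mxE.
have -> : x i 0 = e i by rewrite /e inord_val.
by case: i => [[|[|[|[|]]]]] //= _; field.
Qed.

Lemma lcD (a b y z a' b' y' z' : F) :
  lc a b y z + lc a' b' y' z' = lc (a + a') (b + b') (y + y') (z + z').
Proof. by apply/colP=> -[[|[|[|[|]]]]] //= ?; rewrite !mxE /=; field. Qed.

Lemma lcZ (c a b y z : F) : c *: lc a b y z = lc (c * a) (c * b) (c * y) (c * z).
Proof. by apply/colP=> -[[|[|[|[|]]]]] //= ?; rewrite !mxE /=; field. Qed.

Lemma lcN (a b y z : F) : - lc a b y z = lc (- a) (- b) (- y) (- z).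
Proof. by rewrite -scaleN1r lcZ !mulN1r. Qed.

Lemma lc0 : lc 0 0 0 0 = 0.
Proof. by rewrite -(scale0r (lc 0 0 0 0)) lcZ !mul0r. Qed.

Lemma mink_lc (a b y z a' b' y' z' : F) :
  mink (lc a b y z) (lc a' b' y' z') = (a * b' + a' * b) / 2 - y * y' - z * z'.
Proof. by rewrite /mink !big_ord_recl big_ord0 !mxE /=; field. Qed.

Lemma mink_lc_diag (a b y z : F) :
  mink (lc a b y z) (lc a b y z) = a * b - y ^+ 2 - z ^+ 2.
Proof. by rewrite mink_lc; field. Qed.

Lemma lc_eq0 (a b y z : F) : lc a b y z = 0 -> [/\ a = 0, b = 0, y = 0 & z = 0].
Proof.
move=> e; have h r : mink (lc a b y z) r = 0 by rewrite e mink0l.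
have := h (lc 0 2 0 0); have := h (lc 2 0 0 0).
have := h (lc 0 0 (-1) 0); have := h (lc 0 0 0 (-1)); rewrite !mink_lc.
move=> hz hy hb ha; split.
- by rewrite -ha; field.
- by rewrite -hb; field.
- by rewrite -hy; field.
- by rewrite -hz; field.
Qed.

Lemma mink_nondegenerate u : u != 0 -> exists w, mink w u != 0.
Proof.
have [a [b [y [z ->]]]] := lcP u => u0.
have [a0|a0] := eqVneq a 0; last first.
  exists (lc 0 2 0 0); rewrite mink_lc (_ : _ - _ = a) //; by field.
have [b0|b0] := eqVneq b 0; last first.
  exists (lc 2 0 0 0); rewrite mink_lc (_ : _ - _ = b) //; by field.
have [y0|y0] := eqVneq y 0; last first.
  exists (lc 0 0 (-1) 0); rewrite mink_lc (_ : _ - _ = y) //; by field.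
have [z0|z0] := eqVneq z 0; last first.
  exists (lc 0 0 0 (-1)); rewrite mink_lc (_ : _ - _ = z) //; by field.
by case/eqP: u0; rewrite a0 b0 y0 z0 lc0.
Qed.

(** Null vectors generate the space additively: multiples of [lc 1 1 1 0] and [lc 1 1 0 1] supply y
    and z, and the two light-cone axes correct a and b. *)
Lemma null_ind (P : 'cV[F]_4 -> Prop) :
    (forall u, mink u u = 0 -> P u) -> (forall x y, P x -> P y -> P (x + y)) ->
  forall x, P x.
Proof.
move=> Pn PD x; have [a [b [y [z ->]]]] := lcP x.
have -> : lc a b y z = lc (a - y - z) 0 0 0 + lc 0 (b - y - z) 0 0
                       + lc y y y 0 + lc z z 0 z.
  by rewrite !lcD; congr lc; ring.
by do 3?[apply: (PD)]; apply: Pn; rewrite mink_lc_diag; ring.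
Qed.

End MinkowskiForm.

Lemma mink_map (F : fieldType) (tau : {rmorphism F -> F}) (x y : 'cV[F]_4) :
  mink (map_mx tau x) (map_mx tau y) = tau (mink x y).
Proof.
rewrite rmorph_sum; apply: eq_bigr => i _; rewrite !mxE !rmorphM.
by case: ifP => _; rewrite ?rmorphN rmorph1.
Qed.

(** * Orthogonality among null vectors *)

Section NullVectors.
Variables (F : finFieldType) (hq : (#|F| %% 4 = 3)%N).
Implicit Types (x y z u v w : 'cV[F]_4) (c s : F).
Let two0 : 2 != 0 :> F := two_neq0 hq.

(* The Witt index is 1, because -1 is not a square. *)
Lemma null_parallel u v : mink u u = 0 -> mink v v = 0 -> v != 0 ->
  mink u v = 0 -> exists c, u = c *: v.
Proof.
have [a [b [y [z ->]]]] := lcP two0 u; have [a' [b' [y' [z' ->]]]] := lcP two0 v.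
rewrite !mink_lc_diag // mink_lc // => hu hv v0 huv.
(* The vector a v - a' u is null with first light-cone coordinate 0, so its y and z coordinates have
   squares summing to 0. *)
have [] := @sum_sqr_eq0 F hq (a * y' - a' * y) (a * z' - a' * z).
  have -> : (a * y' - a' * y) ^+ 2 + (a * z' - a' * z) ^+ 2 =
    - a ^+ 2 * (a' * b' - y' ^+ 2 - z' ^+ 2) - a' ^+ 2 * (a * b - y ^+ 2 - z ^+ 2)
    + 2 * a * a' * ((a * b' + a' * b) / 2 - y * y' - z * z') by field.
  by rewrite hu hv huv !mulr0 subr0 addr0.
move=> /eqP; rewrite subr_eq0 => /eqP ey /eqP; rewrite subr_eq0 => /eqP ez.
have [a'0|a'0] := eqVneq a' 0.
  have [y'0 z'0] : y' = 0 /\ z' = 0.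
    apply: (sum_sqr_eq0 hq); apply: oppr_inj; rewrite oppr0 -hv a'0; ring.
  have b'0 : b' != 0 by apply: contra v0 => /eqP ->; rewrite a'0 y'0 z'0 lc0.
  have a0 : a = 0.
    apply: (mulIf b'0); rewrite mul0r; apply: (mulIf (invr_neq0 two0)).
    by rewrite mul0r -huv a'0 y'0 z'0; ring.
  have [y0 z0] : y = 0 /\ z = 0.
    apply: (sum_sqr_eq0 hq); apply: oppr_inj; rewrite oppr0 -hu a0; ring.
  exists (b / b'); rewrite lcZ // a'0 y'0 z'0 a0 y0 z0 !mulr0.
  by congr lc; field.
exists (a / a'); rewrite lcZ //.
have ey' : y = a / a' * y' by rewrite mulrAC ey; field.
have ez' : z = a / a' * z' by rewrite mulrAC ez; field.
congr lc => //; first by field.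
have : (a * b' + a' * b) - 2 * a / a' * (a' * b') = 0.
  rewrite (_ : a' * b' = y' ^+ 2 + z' ^+ 2).
    by rewrite -[RHS](mulr0 2) -[in RHS]huv ey' ez'; field; rewrite a'0 two0.
  by apply/eqP; rewrite -subr_eq0 opprD addrA hv.
move=> h; apply: (mulIf a'0); apply/eqP; rewrite -subr_eq0; apply/eqP.
by rewrite -h; field.
Qed.

(** Pigeonhole: three pairings map q^4 vectors to q^3 values, and the difference of two vectors with
    equal values is orthogonal to all three. *)
Lemma exists_orthogonal u v w :
  exists z, [/\ z != 0, mink z u = 0, mink z v = 0 & mink z w = 0].
Proof.
pose f x := (mink x u, mink x v, mink x w).
have [/injectiveP fI|] := boolP (injectiveb f).
  have := leq_card f fI; rewrite card_mx !card_prod.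
  have -> : (#|F| * #|F| * #|F| = #|F| ^ 3)%N by rewrite !expnS expn0 muln1 mulnA.
  have F1 : (1 < #|F|)%N.
    by have [m ->] := card_3mod4 hq; lia.
  by rewrite leq_exp2l.
case/injectivePn => x [y xy]; rewrite /f => -[/eqP eu /eqP ev /eqP ew].
exists (x - y); rewrite subr_eq0 xy !mink_lin; split=> //.
- by apply/eqP; rewrite subr_eq0.
- by apply/eqP; rewrite subr_eq0.
- by apply/eqP; rewrite subr_eq0.
Qed.

Lemma exists_null_nonorthogonal u : mink u u = 0 -> u != 0 ->
  exists2 v, mink v v = 0 & mink v u != 0.
Proof.
move=> hu u0; have [w hw] := mink_nondegenerate two0 u0.
(* As u is null, (w - c u, w - c u) is affine in c; this c is its root. *)
exists (w - (mink w w / (2 * mink w u)) *: u).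
  by rewrite minkBB !mink_lin hu; field; rewrite hw two0.
by rewrite !mink_lin hu mulr0 subr0.
Qed.

End NullVectors.

(** * Displacements of a null-preserving map and its action on null directions *)

Section NullPreservers.
Variables (F : finFieldType) (hq : (#|F| %% 4 = 3)%N).
Variable psi : 'cV[F]_4 -> 'cV[F]_4.
Hypothesis psi_null : forall r1 r2 : 'cV[F]_4,
  mink (r1 - r2) (r1 - r2) = 0 -> r1 != r2 ->
  mink (psi r1 - psi r2) (psi r1 - psi r2) = 0 /\ psi r1 != psi r2.
Implicit Types (x y z u v w n : 'cV[F]_4) (c s : F).
Let two0 : 2 != 0 :> F := two_neq0 hq.
Local Notation null u := (mink u u = 0).

Definition displ x u := psi (x + u) - psi x.

Lemma displD x u v : displ x (u + v) = displ x u + displ (x + u) v.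
Proof. by rewrite /displ addrA [RHS]addrC addrA subrK. Qed.

Lemma mink_displD w x u v : (forall y, mink w (displ y u) = 0) ->
  (forall y, mink w (displ y v) = 0) -> mink w (displ x (u + v)) = 0.
Proof. by move=> hu hv; rewrite displD minkDr hu hv addr0. Qed.

Lemma displ_shift x u v : displ (x + u) v = displ x (u + v) - displ x u.
Proof. by rewrite displD [RHS]addrC addKr. Qed.

Lemma displ_swap x u v :
  displ (x + u) v - displ x v = displ (x + v) u - displ x u.
Proof.
rewrite /displ (addrAC x v u) !opprB !addrA [LHS]addrAC [RHS]addrAC.
by congr (_ + _); rewrite -!addrA; congr (_ + _); rewrite addrC.
Qed.

Lemma displ0 x : displ x 0 = 0.
Proof. by rewrite /displ addr0 subrr. Qed.

Lemma displ_null_neq0 x u : null u -> u != 0 ->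
  null (displ x u) /\ displ x u != 0.
Proof.
move=> hu u0; have xu : x + u - x = u by rewrite addrC addKr.
rewrite /displ subr_eq0; apply: psi_null; first by rewrite xu.
by rewrite -subr_eq0 xu.
Qed.

Lemma displ_neq0 x u : null u -> u != 0 -> displ x u != 0.
Proof. by move=> hu u0; have [] := displ_null_neq0 x hu u0. Qed.

Lemma displ_null x u : null u -> null (displ x u).
Proof.
move=> hu; have [->|u0] := eqVneq u 0; first by rewrite displ0 mink0l.
by have [] := displ_null_neq0 x hu u0.
Qed.

Lemma null_scale c u : null u -> null (c *: u).
Proof. by move=> hu; rewrite !mink_lin hu !mulr0. Qed.

(** The images of x, x + u and x + v differ pairwise by null vectors; polarization gives
    orthogonality. *)
Lemma displ_orth x u v : null u -> null v -> null (v - u) ->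
  mink (displ x u) (displ x v) = 0.
Proof.
move=> hu hv huv; have := displ_null (x + u) huv.
have -> : displ (x + u) (v - u) = displ x v - displ x u.
  by rewrite displ_shift (addrC u) subrK.
rewrite minkBB !displ_null // add0r addr0 => /eqP.
by rewrite oppr_eq0 mulf_eq0 (negPf two0) /= minkC => /eqP.
Qed.

Lemma displ_line x u : null u -> u != 0 ->
  exists2 c : F -> F, injective c & forall s, displ x (s *: u) = c s *: displ x u.
Proof.
move=> hu u0.
have /fin_all_exists[c hc] : forall s, exists c, displ x (s *: u) = c *: displ x u.
  move=> s; apply: (null_parallel hq); rewrite ?displ_null ?displ_neq0 //.
    exact: null_scale.
  rewrite minkC; apply: displ_orth => //; first exact: null_scale.
  by rewrite -[X in _ - X]scale1r -scalerBl; apply: null_scale.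
exists c => // s t cst; apply/eqP; rewrite -subr_eq0; apply: contraT => st0.
have stu0 : (s - t) *: u != 0 by rewrite scaler_eq0 negb_or st0.
have := displ_neq0 (x + t *: u) (null_scale (s - t) hu) stu0.
have -> : displ (x + t *: u) ((s - t) *: u) = displ x (s *: u) - displ x (t *: u).
  by rewrite displ_shift -scalerDl (addrC t) subrK.
by rewrite !hc cst subrr eqxx.
Qed.

Lemma par_trans u v w : null u -> null v -> null w -> v != 0 ->
  mink u v = 0 -> mink v w = 0 -> mink u w = 0.
Proof.
move=> hu hv hw v0 uv vw; have [c ->] := null_parallel hq hu hv v0 uv.
by rewrite minkZl vw mulr0.
Qed.

Lemma null_comb u v w a b : null u -> null v -> null w ->
  null (u + a *: w - b *: v) ->
  a * mink u w - b * mink u v - b * a * mink v w = 0.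
Proof.
move=> hu hv hw; rewrite !mink_lin hu hv hw (minkC w u) (minkC v u) (minkC w v) => h.
by apply: (mulfI two0); rewrite mulr0 -h; ring.
Qed.

(* The lines x + F u and x + w + F u are perfectly matched by null vectors,
   while two null lines of different directions have no perfect matching. *)
Lemma displ_par_matched x u w : null u -> u != 0 -> null w ->
  mink (displ x u) (displ (x + w) u) = 0.
Proof.
move=> hu u0 hw; apply/eqP; apply: contraT => b0.
have [c cI hc] := displ_line x hu u0.
have [c' c'I hc'] := displ_line (x + w) hu u0.
set m := displ x u in b0 hc; set n := displ (x + w) u in b0 hc'.
pose e := displ x w; have he : null e by apply: displ_null.
have hm : null m by apply: displ_null.
have hn : null n by apply: displ_null.
(* The images of x + s u and x + w + s u differ by a null vector; this is the perfect matching in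
   coordinates. *)
have E s : c' s * mink e n - c s * mink e m - c s * c' s * mink m n = 0.
  have := displ_null (x + s *: u) hw.
  have -> : displ (x + s *: u) w = e + c' s *: n - c s *: m.
    have /eqP := displ_swap x (s *: u) w; rewrite hc hc' subr_eq => /eqP ->.
    by rewrite addrC addrA.
  exact: null_comb.
have c_neq0 (f : F -> F) k : injective f -> f 0 = 0 -> k != 0 -> f k != 0.
  by move=> fI f0; apply: contra => /eqP fk; apply/eqP/fI; rewrite fk f0.
have c0 : c 0 = 0.
  have /eqP := hc 0; rewrite scale0r displ0 eq_sym scaler_eq0.
  by rewrite (negPf (displ_neq0 x hu u0)) orbF => /eqP.
have c'0 : c' 0 = 0.
  have /eqP := hc' 0; rewrite scale0r displ0 eq_sym scaler_eq0.
  by rewrite (negPf (displ_neq0 (x + w) hu u0)) orbF => /eqP.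
have N1 : -1 != 0 :> F by rewrite oppr_eq0 oner_eq0.
have N1' : 1 != -1 :> F by rewrite -subr_eq0 opprK.
have [g gK cK] := injF_bij cI.
(* At this value of [c s] the terms in [c' s] cancel, which forces (e, n) (e, m) = 0. In either case
   [c'] or [c] is then constant on nonzero arguments, against injectivity at 1 and -1. *)
have := E (g (mink e n / mink m n)); rewrite !cK.
have -> : forall t, t * mink e n - mink e n / mink m n * mink e m
   - mink e n / mink m n * t * mink m n = - (mink e n * mink e m / mink m n).
  by move=> t; field.
move/eqP; rewrite oppr_eq0 !mulf_eq0 invr_eq0 (negPf b0) orbF => /orP[]/eqP z0.
  have c'E s : s != 0 -> c' s = - mink e m / mink m n.
    move=> s0; apply: (mulIf b0); apply: (mulfI (c_neq0 _ _ cI c0 s0)).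
    have := E s; rewrite z0 mulr0 sub0r => /eqP; rewrite subr_eq0 eq_sym mulrA => /eqP ->.
    by field.
  by case/eqP: N1'; apply: c'I; rewrite !c'E ?oner_eq0.
have cE s : s != 0 -> c s = mink e n / mink m n.
  move=> s0; apply: (mulIf b0); apply: (mulfI (c_neq0 _ _ c'I c'0 s0)).
  have := E s; rewrite z0 mulr0 subr0 => /eqP; rewrite subr_eq0 eq_sym => /eqP h.
  by rewrite mulrA (mulrC (c' s)) h; field.
by case/eqP: N1'; apply: cI; rewrite !cE ?oner_eq0.
Qed.

(** Any two base points are joined by a chain of null steps, and parallelism of nonzero null vectors
    is transitive. *)
Lemma displ_par x y u : null u -> u != 0 -> mink (displ x u) (displ y u) = 0.
Proof.
move=> hu u0; move: y.
suff H y : forall w, null w -> mink (displ x u) (displ y u) = 0 ->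
    mink (displ x u) (displ (y + w) u) = 0.
  suff K y : forall z, mink (displ x u) (displ z u) = 0 ->
      mink (displ x u) (displ (z + y) u) = 0.
    by move=> y; rewrite -(subrK x y) addrC; apply: K; apply: displ_null.
  elim/(null_ind two0): y => [w hw z|y y' IHy IHy' z hz]; first exact: H.
  by rewrite addrA; apply/IHy'/IHy.
move=> w hw h; apply: (par_trans _ _ _ (displ_neq0 y hu u0) h).
- exact: displ_null.
- exact: displ_null.
- exact: displ_null.
exact: displ_par_matched.
Qed.

Lemma displ_dir x y u s : null u -> u != 0 ->
  exists c, displ y (s *: u) = c *: displ x u.
Proof.
move=> hu u0; have [c _ hc] := displ_line y hu u0.
have [d dE] : exists d, displ y u = d *: displ x u.
  apply: (null_parallel hq) (displ_par _ _ hu u0); rewrite ?displ_null //.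
  exact: displ_neq0.
by exists (c s * d); rewrite hc dE scalerA.
Qed.

Lemma displ_dir1 x y u : null u -> u != 0 ->
  exists2 c, c != 0 & displ y u = c *: displ x u.
Proof.
move=> hu u0; have [c cE] := displ_dir x y 1 hu u0; rewrite scale1r in cE.
exists c => //; have := displ_neq0 y hu u0.
by rewrite cE scaler_eq0 negb_or => /andP[].
Qed.

Local Notation dir u := (displ 0 u).

(** Around a parallelogram, the change of the displacement along v, a multiple of [dir v], equals
    the change of that along u, a multiple of [dir u]. These are not parallel, so both changes
    vanish. *)
Lemma displ_transl u v x s : null u -> u != 0 -> null v -> v != 0 ->
  mink (dir u) (dir v) != 0 -> displ (x + s *: u) v = displ x v.
Proof.
move=> hu u0 hv v0 uv; apply/eqP; rewrite -subr_eq0.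
have [k1 _ k1E] := displ_dir1 0 (x + s *: u) hv v0.
have [k2 _ k2E] := displ_dir1 0 x hv v0.
have := displ_swap x (s *: u) v.
have [l1 ->] := displ_dir 0 (x + v) s hu u0.
have [l2 ->] := displ_dir 0 x s hu u0.
rewrite k1E k2E -!scalerBl => /(congr1 (mink (dir u))).
rewrite !minkZr displ_null // mulr0 => /eqP.
by rewrite mulf_eq0 (negPf uv) orbF => /eqP ->; rewrite scale0r.
Qed.

Lemma dirZ_eq0 u v s : null u -> u != 0 -> s != 0 ->
  mink v (dir (s *: u)) = 0 -> mink v (dir u) = 0.
Proof.
move=> hu u0 s0; have [c cE] := displ_dir 0 0 s hu u0.
rewrite cE minkZr => /eqP; rewrite mulf_eq0 => /orP[/eqP c0|/eqP //].
have su0 : s *: u != 0 by rewrite scaler_eq0 negb_or s0.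
by have := displ_neq0 0 (null_scale s hu) su0; rewrite cE c0 scale0r eqxx.
Qed.

(** * Two null directions with the same image *)

Section Collapse.
Variables u v : 'cV[F]_4.
Hypotheses (hu : null u) (u0 : u != 0) (hv : null v) (v0 : v != 0).
Hypotheses (uv : mink u v != 0) (duv : mink (dir u) (dir v) = 0).

Let displ_plane x a b : exists k, displ x (a *: u + b *: v) = k *: dir u.
Proof.
have [k kE] : exists k, dir v = k *: dir u.
  by apply: (null_parallel hq); rewrite ?displ_null ?displ_neq0 // minkC.
have [k1 k1E] := displ_dir 0 x a hu u0.
have [k2 k2E] := displ_dir 0 (x + a *: u) b hv v0.
by exists (k1 + k2 * k); rewrite displD k1E k2E kE scalerDl scalerA.
Qed.

(** With d = a u + b v, the displacement along d is k [dir u], and that along w is l [dir w] with l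
    nonzero, unchanged by shifting by d. Since d + w is null, 2 k l ([dir u], [dir w]) = 0, hence k
    = 0. *)
Lemma collapse_null_shift w a b p : null w -> w != 0 -> mink (dir u) (dir w) != 0 ->
  null (a *: u + b *: v + w) -> psi (p + (a *: u + b *: v)) = psi p.
Proof.
move=> hw w0 uw hd; set d := a *: u + b *: v in hd *.
have vw : mink (dir v) (dir w) != 0.
  apply: contra uw => /eqP vw; apply/eqP.
  by apply: par_trans vw; rewrite ?displ_null ?displ_neq0.
have dE : displ (p + d) w = displ p w.
  by rewrite /d addrA !displ_transl.
have [k kE] : exists k, displ p d = k *: dir u by apply: displ_plane.
have [l l0 lE] := displ_dir1 0 p hw w0.
have := displ_null p hd; rewrite displD dE kE lE minkDD !(minkZl, minkZr).
rewrite !displ_null // !mulr0 add0r addr0 => /eqP.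
rewrite !mulf_eq0 (negPf two0) (negPf l0) (negPf uw) !orbF /= => /eqP k0.
by apply/eqP; rewrite -subr_eq0 -/(displ p d) kE k0 scale0r.
Qed.

Lemma collapse_exists_null w0 a b : null w0 -> mink (dir u) (dir w0) != 0 ->
  b != 0 -> exists w, [/\ null w, mink (dir u) (dir w) != 0 &
                        mink w (a *: u + b *: v) != 0].
Proof.
move=> hw0 uw0 b0; set d := _ + _.
have [wd|wd] := eqVneq (mink w0 d) 0; last by exists w0.
have [z [z0 zw zu zv]] := exists_orthogonal hq w0 u v.
have w00 : w0 != 0 by apply: contra uw0 => /eqP ->; rewrite displ0 mink0r.
have Qz : mink z z != 0.
  apply/eqP=> hz; have [c cE] := null_parallel hq hz hu u0 zu.
  move: zv; rewrite cE minkZl => /eqP; rewrite mulf_eq0 (negPf uv) orbF => /eqP c0.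
  by case/eqP: z0; rewrite cE c0 scale0r.
have wu : mink w0 u != 0.
  apply: contra uw0 => /eqP wu; have [c ->] := null_parallel hq hw0 hu u0 wu.
  by have [k ->] := displ_dir 0 0 c hu u0; rewrite minkZr displ_null // mulr0.
(* This t makes both w0 + t u + z and w0 + t u - z null; each pairs with d to t b (u, v), which is
   nonzero. *)
pose t := - mink z z / (2 * mink w0 u).
have t0 : t != 0 by rewrite mulf_neq0 ?oppr_eq0 // invr_eq0 mulf_neq0.
have hw e : e ^+ 2 = 1 -> null (w0 + t *: u + e *: z).
  move=> e2; rewrite !mink_lin hu hw0 zw zu (minkC w0 z) (minkC u z) zw zu (minkC u w0).
  transitivity (t * (2 * mink w0 u) + e ^+ 2 * mink z z); first by ring.
  by rewrite e2 /t; field; rewrite wu two0.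
have wd' e : mink (w0 + t *: u + e *: z) d != 0.
  suff -> : mink (w0 + t *: u + e *: z) d = t * (b * mink u v).
    exact: mulf_neq0 t0 (mulf_neq0 b0 uv).
  by rewrite !minkDl wd /d !mink_lin zu zv hu; ring.
have hw1 := hw 1 (expr1n _ _).
have hw2 : null (w0 + t *: u + (-1) *: z) by apply: hw; rewrite sqrrN expr1n.
have [e1|] := eqVneq (mink (dir u) (dir (w0 + t *: u + 1 *: z))) 0; last first.
  by exists (w0 + t *: u + 1 *: z).
have [e2|] := eqVneq (mink (dir u) (dir (w0 + t *: u + (-1) *: z))) 0; last first.
  by exists (w0 + t *: u + (-1) *: z).
exfalso; case/eqP: uw0.
apply: (@dirZ_eq0 w0 _ 2) => //.
(* If both candidates had the image direction of u, so would w0, as 2 w0 is their sum minus 2 t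
   u. *)
have -> : 2 *: w0 = (w0 + t *: u + 1 *: z) + (w0 + t *: u + (-1) *: z)
   + (- 2 * t) *: u.
  by apply/matrixP=> i j; rewrite !mxE; ring.
have nz w : mink w d != 0 -> w != 0.
  by apply: contra => /eqP ->; rewrite mink0l.
have par w x : null w -> mink w d != 0 -> mink (dir u) (dir w) = 0 ->
    mink (dir u) (displ x w) = 0.
  move=> hw' wd1 uw; have [c _ ->] := displ_dir1 0 x hw' (nz _ wd1).
  by rewrite minkZr uw mulr0.
apply: mink_displD => [x|x]; last first.
  by have [k ->] := displ_dir 0 x (- 2 * t) hu u0; rewrite minkZr displ_null // mulr0.
by apply: mink_displD => y; apply: par.
Qed.

Lemma collapse_all w : null w -> mink (dir u) (dir w) = 0.
Proof.
move=> hw; apply/eqP; apply: contraT => uw.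
have shift a b p : a != 0 -> b != 0 -> psi (p + (a *: u + b *: v)) = psi p.
  move=> a0 b0; have [y [hy uy yd]] := collapse_exists_null a hw uw b0.
  set d := _ + _ in yd *.
  have y0 : y != 0 by apply: contra uy => /eqP ->; rewrite displ0 mink0r.
  have Qd : mink d d != 0.
    rewrite /d !mink_lin hu hv (minkC v u).
    rewrite (_ : _ + _ = 2 * a * b * mink u v); last by ring.
    by rewrite !mulf_neq0.
  (* Chosen so that d + t y is null. *)
  pose t := - mink d d / (2 * mink y d).
  have t0 : t != 0 by rewrite mulf_neq0 ?oppr_eq0 // invr_eq0 mulf_neq0.
  apply: (@collapse_null_shift (t *: y)).
  - exact: null_scale.
  - by rewrite scaler_eq0 negb_or t0.
  - by apply: contra uy => /eqP h; apply/eqP; apply: dirZ_eq0 h.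
  - rewrite -/d minkDD !(minkZl, minkZr) hy !mulr0 addr0 (minkC d y) /t.
    by field; rewrite two0 yd.
have N1 : -1 != 0 :> F by rewrite oppr_eq0 oner_eq0.
have u20 : 2 *: u != 0 by rewrite scaler_eq0 negb_or two0.
have := displ_neq0 0 (null_scale 2 hu) u20; rewrite /displ.
(* Both summands leave [psi] unchanged, although 2 u is a nonzero null vector. *)
have -> : 0 + 2 *: u = 0 + (1 *: u + 1 *: v) + (1 *: u + (-1) *: v).
  by apply/matrixP=> i j; rewrite !mxE; ring.
by rewrite !shift ?oner_eq0 // subrr eqxx.
Qed.

End Collapse.
(** Otherwise [psi] takes values on one line, and the coordinate [f] on it colours the points with q
    colours so that points differing by a nonzero null vector get different colours. *)
Lemma not_all_collapsed u : null u -> u != 0 ->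
  ~ (forall w, null w -> mink (dir u) (dir w) = 0).
Proof.
move=> hu u0 coll.
have du0 := displ_neq0 0 hu u0.
have line y : forall x, exists k, displ x y = k *: dir u.
  elim/(null_ind two0): y => [w hw x|y y' IH IH' x]; last first.
    have [k kE] := IH x; have [k' k'E] := IH' (x + y).
    by exists (k + k'); rewrite displD kE k'E scalerDl.
  have [->|w0] := eqVneq w 0; first by exists 0; rewrite displ0 scale0r.
  have [c _ ->] := displ_dir1 0 x hw w0.
  have [d ->] : exists d, dir w = d *: dir u.
    by apply: (null_parallel hq) (du0) _; rewrite ?displ_null // minkC coll.
  by exists (c * d); rewrite scalerA.
have /fin_all_exists[f fE] : forall y, exists k, dir y = k *: dir u.
  by move=> y; apply: line.
have fN x y : null (x - y) -> x - y != 0 -> f x != f y.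
  move=> xy xy0.
  apply: contra (displ_neq0 y xy xy0) => /eqP e.
  have := displ_shift 0 y (x - y); rewrite add0r => ->.
  by rewrite (addrC y) subrK (fE x) (fE y) e subrr.
(* Each line along the b axis is null, so [f] is bijective on it and takes the colour 0 there. *)
have slice a : exists g : F * F -> F, forall p, f (lc a (g p) p.1 p.2) = 0.
  apply: (@fin_all_exists _ (fun=> F) (fun p b => f (lc a b p.1 p.2) = 0)) => p.
  have fI : injective (fun b => f (lc a b p.1 p.2)).
    move=> b b' e; apply/eqP; apply: contraT => bb'.
    have := @fN (lc a b p.1 p.2) (lc a b' p.1 p.2); rewrite e eqxx.
    rewrite lcN // lcD // mink_lc_diag // => H.
    suff : false by []; apply: H; first by ring.
    apply/eqP=> /lc_eq0[] // _ /eqP.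
    by rewrite subr_eq0 (negPf bb').
  have [g _ gK] := injF_bij fI.
  by exists (g 0).
have [g0 g0E] := slice 0; have [g1 g1E] := slice 1.
have [p [y gE]] := exists_null_between_slices two0 g0 g1.
have := @fN (lc 1 (g1 y) y.1 y.2) (lc 0 (g0 p) p.1 p.2).
rewrite g0E g1E eqxx lcN // lcD // mink_lc_diag // => H.
suff : false by []; apply: H; first by rewrite gE; ring.
by apply/eqP=> /lc_eq0[] // /eqP; rewrite subr0 oner_eq0.
Qed.

Lemma dir_nonorthogonal u v : null u -> null v -> mink u v != 0 ->
  mink (dir u) (dir v) != 0.
Proof.
move=> hu hv uv; apply/eqP=> duv.
have u0 : u != 0 by apply: contra uv => /eqP ->; rewrite mink0l.
have v0 : v != 0 by apply: contra uv => /eqP ->; rewrite mink0r.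
exact: not_all_collapsed hu u0 (collapse_all hu u0 hv v0 uv duv).
Qed.

(** The case left is u = c v. It reduces to the nonparallel one by writing c v as a sum of three
    null vectors not orthogonal to v. *)
Lemma displ_transl_null u v x : null u -> null v -> displ (x + u) v = displ x v.
Proof.
move=> hu hv; have [->|v0] := eqVneq v 0; first by rewrite !displ0.
have [uv|uv] := eqVneq (mink u v) 0; last first.
  have u0 : u != 0 by apply: contra uv => /eqP ->; rewrite mink0l.
  by rewrite -(scale1r u) displ_transl // dir_nonorthogonal.
have [c ->] := null_parallel hq hu hv v0 uv.
have [->|c0] := eqVneq c 0; first by rewrite scale0r addr0.
have [m hm mv] := exists_null_nonorthogonal hq hv v0.
have [z [z0 zm zv _]] := exists_orthogonal hq m v v.
have Qz : mink z z != 0.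
  apply/eqP=> hz; have [k kE] := null_parallel hq hz hv v0 zv.
  move: zm; rewrite kE minkZl minkC => /eqP.
  rewrite mulf_eq0 (negPf mv) orbF => /eqP k0.
  by case/eqP: z0; rewrite kE k0 scale0r.
(* Makes s m + (c / 2) v + z and s m + (c / 2) v - z null; their sum is c v + 2 s m. *)
pose s := - mink z z / (c * mink m v).
have s0 : s != 0 by rewrite mulf_neq0 ?oppr_eq0 // invr_eq0 mulf_neq0.
pose r e := s *: m + (c / 2) *: v + e *: z.
have hr e : e ^+ 2 = 1 -> null (r e).
  move=> e2; rewrite /r !mink_lin hm hv (minkC v m) (minkC v z) (minkC m z) zm zv.
  transitivity (s * (c * mink m v) + e ^+ 2 * mink z z); first by field.
  by rewrite e2 /s; field; rewrite mv c0.
have rv e : mink (r e) v != 0.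
  rewrite /r !mink_lin hv zv !mulr0 !addr0; exact: mulf_neq0.
have nz w : mink w v != 0 -> w != 0.
  by apply: contra => /eqP ->; rewrite mink0l.
have -> : x + c *: v = x + 1 *: r 1 + 1 *: r (-1) + (- 2 * s) *: m.
  by apply/matrixP=> i j; rewrite /r !mxE; field.
have hr1 : null (r 1) by apply: hr; rewrite expr1n.
have hrN1 : null (r (-1)) by apply: hr; rewrite sqrrN expr1n.
by rewrite !displ_transl // ?nz // dir_nonorthogonal.
Qed.

Lemma displ_additive x y : displ x y = dir y.
Proof.
have H v : null v -> forall z x, displ (x + z) v = displ x v.
  move=> hv; elim/(null_ind two0) => [u hu z|z z' IH IH' t].
    exact: displ_transl_null.
  by rewrite addrA IH' IH.
move: x; elim/(null_ind two0): y => [u hu x|y y' IH IH' x].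
  by rewrite -(H u hu x 0) add0r.
by rewrite !displD IH !IH'.
Qed.

End NullPreservers.

Lemma pack_rmorphism (R S : nzRingType) (f : R -> S) :
    (forall x y, f (x + y) = f x + f y) -> (forall x y, f (x * y) = f x * f y) ->
    f 1 = 1 ->
  exists g : {rmorphism R -> S}, g =1 f.
Proof.
move=> fD fM f1.
have fB : zmod_morphism f.
  by move=> x y; apply/eqP; rewrite eq_sym subr_eq -fD subrK.
have fmul : monoid_morphism f by [].
pose g : {rmorphism R -> S} := HB.pack f
  (GRing.isZmodMorphism.Build R S f fB) (GRing.isMonoidMorphism.Build R S f fmul).
by exists g.
Qed.

(** * Additive null-preserving maps are semilinear similarities *)

Section AdditiveNullPreservers.
Variables (F : finFieldType) (hq : (#|F| %% 4 = 3)%N).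
Variable phi : 'cV[F]_4 -> 'cV[F]_4.
Local Notation null u := (mink u u = 0).
Hypothesis phiD : forall x y, phi (x + y) = phi x + phi y.
Hypothesis phi_null : forall u, null u -> null (phi u).
Hypothesis phi_line : forall u s, null u -> exists c, phi (s *: u) = c *: phi u.
Hypothesis phi_nonorth : forall u v, null u -> null v -> mink u v != 0 ->
  mink (phi u) (phi v) != 0.
Let two0 : 2 != 0 :> F := two_neq0 hq.

Let ea : 'cV[F]_4 := lc 1 0 0 0.
Let eb : 'cV[F]_4 := lc 0 1 0 0.
Let lam := mink (phi ea) (phi eb).

Lemma phi0 : phi 0 = 0.
Proof. by apply: (addrI (phi 0)); rewrite -phiD !addr0. Qed.
Lemma phiN x : phi (- x) = - phi x.
Proof. by apply: (addrI (phi x)); rewrite -phiD !subrr phi0. Qed.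

Lemma lam0 : lam != 0.
Proof.
apply: phi_nonorth; rewrite /ea /eb ?mink_lc_diag ?mink_lc //; try by ring.
by rewrite (_ : _ - _ = 2^-1) ?invr_eq0 //; field.
Qed.

Lemma lcE (a b y z : F) :
  phi (lc a b y z) = phi (lc a 0 0 0) + phi (lc 0 b 0 0) + phi (lc 0 0 y z).
Proof. by rewrite -!phiD !lcD // !add0r !addr0. Qed.

(* a ea + b eb + z and a ea + b eb - z are both null, hence the two components
   vanish separately. *)
Lemma phi_split (a b y z : F) : a * b = y ^+ 2 + z ^+ 2 ->
  2 * mink (phi (lc a 0 0 0)) (phi (lc 0 b 0 0))
    + mink (phi (lc 0 0 y z)) (phi (lc 0 0 y z)) = 0
  /\ mink (phi (lc a 0 0 0)) (phi (lc 0 0 y z))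
     + mink (phi (lc 0 b 0 0)) (phi (lc 0 0 y z)) = 0.
Proof.
move=> ab.
have h1 : null (phi (lc a b y z)).
  by apply: phi_null; rewrite mink_lc_diag // ab; ring.
have h2 : null (phi (lc a b (- y) (- z))).
  by apply: phi_null; rewrite mink_lc_diag // ab; ring.
have ha : null (phi (lc a 0 0 0)) by apply: phi_null; rewrite mink_lc_diag //; ring.
have hb : null (phi (lc 0 b 0 0)) by apply: phi_null; rewrite mink_lc_diag //; ring.
move: h1 h2; rewrite (lcE a b (- y)) (lcE a b y).
have -> : lc 0 0 (- y) (- z) = - lc 0 0 y z by rewrite lcN // oppr0.
rewrite phiN; move: (phi _) (phi _) (phi _) ha hb => A B Z hA hB.
rewrite !mink_lin hA hB (minkC Z A) (minkC Z B) (minkC B A) => h1 h2.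
split; apply: (mulfI two0).
  have := congr2 +%R h1 h2; rewrite [0 + 0]addr0 mulr0 => <-; ring.
apply: (mulfI two0); have := congr2 (fun a b => a - b) h1 h2.
by rewrite [0 - 0]subr0 !mulr0 => <-; ring.
Qed.

Let tau a := mink (phi (lc a 0 0 0)) (phi eb) / lam.

(** Write a b = y^2 + z^2: by [phi_split], the pairs (a, b) and (a b, 1) are completed by the same
    transverse vector, so their pairings agree. *)
Lemma phi_prod a b : mink (phi (lc a 0 0 0)) (phi (lc 0 b 0 0)) = lam * tau (a * b).
Proof.
have [y [z yz]] := sum_two_squares hq (a * b).
have [e1 _] := phi_split (esym yz).
have [|e2 _] := @phi_split (a * b) 1 y z; first by rewrite mulr1.
rewrite /tau [RHS]mulrC (mulfVK lam0); apply: (mulfI two0).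
apply: (addIr (mink (phi (lc 0 0 y z)) (phi (lc 0 0 y z)))).
exact: etrans e1 (esym e2).
Qed.

Lemma null_a a : null (lc a 0 0 0 : 'cV[F]_4).
Proof. by rewrite mink_lc_diag //; ring. Qed.
Lemma null_b b : null (lc 0 b 0 0 : 'cV[F]_4).
Proof. by rewrite mink_lc_diag //; ring. Qed.

Lemma phi_a a : phi (lc a 0 0 0) = tau a *: phi ea.
Proof.
have [c cE] := phi_line a (null_a 1).
have -> : lc a 0 0 0 = a *: lc 1 0 0 0 by rewrite lcZ // !mulr0 mulr1.
rewrite cE /tau; congr (_ *: _).
have -> : lc a 0 0 0 = a *: lc 1 0 0 0 by rewrite lcZ // !mulr0 mulr1.
by rewrite cE minkZl (mulfK lam0).
Qed.

Lemma phi_b b : phi (lc 0 b 0 0) = tau b *: phi eb.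
Proof.
have [c cE] := phi_line b (null_b 1).
have bE : lc 0 b 0 0 = b *: lc 0 1 0 0 by rewrite lcZ // !mulr0 mulr1.
rewrite bE cE; congr (_ *: _); apply: (mulfI lam0).
have := phi_prod 1 b; rewrite mul1r => <-.
by rewrite bE cE minkZr mulrC.
Qed.

Lemma tau1 : tau 1 = 1.
Proof. exact: divff lam0. Qed.

Lemma tauM a b : tau (a * b) = tau a * tau b.
Proof.
by apply: (mulfI lam0); rewrite -phi_prod phi_a phi_b !mink_lin -/lam; ring.
Qed.

Lemma tauD a b : tau (a + b) = tau a + tau b.
Proof.
rewrite /tau -mulrDl -minkDl -phiD lcD // !addr0 //.
Qed.

Lemma tau_neq0 a : a != 0 -> tau a != 0.
Proof.
move=> a0; apply/eqP=> t0; have := tauM a a^-1.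
by rewrite divff // tau1 t0 mul0r => /eqP; rewrite oner_eq0.
Qed.

(** [A] and [X] are additive with A + tau(N) X = 0 at norm N. Adding to (y, z) either of its quarter
    turns gives a vector of norm 2N; combining these relations leaves 2 tau(N) X(y, z) = 0. *)
Lemma phi_orth (y z : F) : mink (phi ea) (phi (lc 0 0 y z)) = 0 /\
  mink (phi eb) (phi (lc 0 0 y z)) = 0.
Proof.
pose A (y z : F) := mink (phi ea) (phi (lc 0 0 y z)).
pose X (y z : F) := mink (phi eb) (phi (lc 0 0 y z)).
have AX (y1 z1 : F) : A y1 z1 + tau (y1 ^+ 2 + z1 ^+ 2) * X y1 z1 = 0.
  have [|_] := @phi_split 1 (y1 ^+ 2 + z1 ^+ 2) y1 z1; first by rewrite mul1r.
  by rewrite phi_b minkZl.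
have AD (y1 z1 y2 z2 : F) : A (y1 + y2) (z1 + z2) = A y1 z1 + A y2 z2.
  by rewrite /A -minkDr -phiD lcD // !addr0.
have XD (y1 z1 y2 z2 : F) : X (y1 + y2) (z1 + z2) = X y1 z1 + X y2 z2.
  by rewrite /X -minkDr -phiD lcD // !addr0.
suff X0 : X y z = 0.
  by split=> //; have := AX y z; rewrite X0 mulr0 addr0.
have [N0|N0] := eqVneq (y ^+ 2 + z ^+ 2) 0.
  by have [-> ->] := sum_sqr_eq0 hq N0; rewrite /X lc0 // phi0 mink0r.
set N := y ^+ 2 + z ^+ 2 in N0.
have e1 := AX y z; have e2 := AX (- z) y; have e3 := AX z (- y).
have e4 := AX (y - z) (z + y); have e5 := AX (y + z) (z - y).
have n2 : (- z) ^+ 2 + y ^+ 2 = N by rewrite /N; ring.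
have n3 : z ^+ 2 + (- y) ^+ 2 = N by rewrite /N; ring.
have n4 : (y - z) ^+ 2 + (z + y) ^+ 2 = N + N by rewrite /N; ring.
have n5 : (y + z) ^+ 2 + (z - y) ^+ 2 = N + N by rewrite /N; ring.
have opp : X (- z) y + X z (- y) = 0.
  by rewrite -XD addrC subrr subrr /X lc0 // phi0 mink0r.
rewrite n2 in e2; rewrite n3 in e3; rewrite n4 tauD AD XD in e4.
rewrite n5 tauD AD XD in e5; rewrite -/N in e1.
have t0 := tau_neq0 N0.
apply: (mulfI (mulf_neq0 two0 t0)); rewrite mulr0.
transitivity ((A y z + A (- z) y + (tau N + tau N) * (X y z + X (- z) y))
     + (A y z + A z (- y) + (tau N + tau N) * (X y z + X z (- y)))
     - 2 * (A y z + tau N * X y z) - (A (- z) y + tau N * X (- z) y)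
     - (A z (- y) + tau N * X z (- y)) - tau N * (X (- z) y + X z (- y))).
  by ring.
by rewrite e1 e2 e3 e4 e5 opp; ring.
Qed.

(** The null vector [lc 1 1 y z] is scaled as a whole, and pairing with [phi ea] identifies the
    factor as [tau s]. *)
Lemma phi_null_scale (y z : F) : y ^+ 2 + z ^+ 2 = 1 -> forall s,
  phi (lc 0 0 (s * y) (s * z)) = tau s *: phi (lc 0 0 y z).
Proof.
move=> yz s.
have hw : null (lc 1 1 y z : 'cV[F]_4).
  by rewrite mink_lc_diag // mulr1 -{1}yz; ring.
have [k] := phi_line s hw; rewrite lcZ // mulr1 (lcE s s) (lcE 1 1) (phi_a s) (phi_b s) => E.
have kE : k = tau s.
  have := congr1 (mink (phi ea)) E; rewrite !mink_lin.
  have [-> _] := phi_orth y z; have [-> _] := phi_orth (s * y) (s * z).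
  rewrite (phi_null (null_a 1)) -/lam !mulr0 !add0r !addr0.
  by move/(mulIf lam0).
move: E; rewrite kE !scalerDr => /addrI //.
Qed.

Lemma phi_lc (a b y z : F) : phi (lc a b y z) = tau a *: phi ea + tau b *: phi eb
  + tau y *: phi (lc 0 0 1 0) + tau z *: phi (lc 0 0 0 1).
Proof.
rewrite lcE phi_a phi_b -!addrA; congr (_ + (_ + _)).
have -> : lc 0 0 y z = lc 0 0 (y * 1) (y * 0) + lc 0 0 (z * 0) (z * 1).
  by rewrite lcD //; congr lc; ring.
by rewrite phiD !phi_null_scale //; ring.
Qed.

Lemma additive_null_preserver : exists (tau : {rmorphism F -> F}) (M : 'M[F]_4) (k : F),
  [/\ k != 0, forall x, phi x = M *m map_mx tau x &
      forall x y, mink (M *m x) (M *m y) = k * mink x y].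
Proof.
have tau0 : tau 0 = 0 by apply: (addrI (tau 0)); rewrite -tauD !addr0.
have [t tE] := pack_rmorphism tauD tauM tau1.
have phiZ c x : phi (c *: x) = t c *: phi x.
  have [a [b [y [z ->]]]] := lcP two0 x.
  by rewrite lcZ // (phi_lc a) (phi_lc (c * a)) !tauM !scalerDr !scalerA tE.
pose M : 'M[F]_4 := \matrix_(i, j) phi (delta_mx j 0) i 0.
have phiM x : phi x = M *m map_mx t x.
  rewrite {1}(matrix_sum_delta x).
  under eq_bigr do rewrite big_ord1.
  rewrite (big_morph phi phiD phi0); apply/colP=> i.
  rewrite summxE mxE; apply: eq_bigr => j _.
  by rewrite phiZ !mxE mulrC.
exists t, M, (2 * lam); split=> //; first exact: mulf_neq0 two0 lam0.
(* Bijectivity of [t] lets x be a [t]-image. The factor is 2 [lam] because ([ea], [eb]) = 1/2;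
   [phi_split] with b = 1 gives the transverse part, and polarization follows. *)
have QM x : mink (M *m x) (M *m x) = 2 * lam * mink x x.
  have tI : injective t by apply: fmorph_inj.
  have [g gK Kg] := injF_bij tI.
  have -> : x = map_mx t (map_mx g x) by apply/matrixP=> i j; rewrite !mxE Kg.
  move: (map_mx g x) => {x} x; rewrite -phiM mink_map.
  have [a [b [y [z ->]]]] := lcP two0 x.
  rewrite mink_lc_diag // lcE phi_a phi_b.
  have [e1 _] := @phi_split (y ^+ 2 + z ^+ 2) 1 y z (mulr1 _).
  rewrite -/eb phi_a minkZl -/lam in e1.
  have [o1 o2] := phi_orth y z.
  move: (phi (lc 0 0 y z)) e1 o1 o2 => Z e1 o1 o2.
  rewrite !mink_lin (minkC Z (phi ea)) (minkC Z (phi eb)) o1 o2.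
  rewrite (phi_null (null_a 1)) (phi_null (null_b 1)) (minkC (phi eb)) -/lam.
  rewrite !rmorphB rmorphM !tE.
  rewrite -[RHS]addr0 -[X in _ = _ + X]e1 tauD; ring.
move=> x y; apply: (mulfI two0).
transitivity (mink (M *m (x + y)) (M *m (x + y)) - mink (M *m x) (M *m x)
              - mink (M *m y) (M *m y)).
  by rewrite mulmxDr minkDD; ring.
by rewrite !QM minkDD; ring.
Qed.

End AdditiveNullPreservers.

(** * Similarities of the form and the two directions of the equivalence *)

Lemma similarity_null (F : fieldType) (M : 'M[F]_4) (k : F) (x : 'cV[F]_4) :
    2 != 0 :> F -> k != 0 ->
    (forall r1 r2, mink (M *m r1) (M *m r2) = k * mink r1 r2) ->
  mink x x = 0 -> x != 0 -> mink (M *m x) (M *m x) = 0 /\ M *m x != 0.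
Proof.
move=> two0 k0 MM hx x0; rewrite MM hx mulr0; split=> //.
have [w wx] := mink_nondegenerate two0 x0.
apply: contra wx => /eqP Mx0; rewrite -(inj_eq (mulfI k0)) -MM Mx0.
by rewrite mink0r mulr0.
Qed.

Theorem theorem4p9 (F : finFieldType) (hq : (#|F| %% 4 = 3)%N)
    (psi : 'cV[F]_4 -> 'cV[F]_4) :
  (forall r1 r2 : 'cV[F]_4,
      mink (r1 - r2) (r1 - r2) = 0 -> r1 != r2 ->
      mink (psi r1 - psi r2) (psi r1 - psi r2) = 0 /\ psi r1 != psi r2)
  <->
  (exists (alpha : F) (r0 : 'cV[F]_4) (tau : {rmorphism F -> F})
          (M : 'M[F]_4),
      [/\ alpha != 0, bijective tau, lorentz M \/ antilorentz M &
          forall r, psi r = alpha *: (M *m map_mx tau r) + r0]).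
Proof.
have two0 := two_neq0 hq; split=> [psi_null|]; last first.
  move=> [alpha [r0 [tau [M [alpha0 _ LM psiE]]]]] r1 r2 h12 n12.
  have [k [k0 Mk]] : exists k, k != 0 /\
      forall x y, mink (M *m x) (M *m y) = k * mink x y.
    case: LM => LM; [exists 1|exists (-1)]; rewrite ?oppr_eq0 oner_eq0; split=> // x y.
      by rewrite LM mul1r.
    by rewrite LM mulN1r.
  rewrite -[psi r1 == _]subr_eq0.
  have -> : psi r1 - psi r2 = alpha *: (M *m map_mx tau (r1 - r2)).
    by rewrite !psiE opprD addrACA subrr addr0 -scalerBr -mulmxBr map_mxB.
  have [] := @similarity_null F M k (map_mx tau (r1 - r2)) two0 k0 Mk.
  - by rewrite mink_map h12 rmorph0.
  - by rewrite map_mx_eq0 subr_eq0.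
  move=> h h0; rewrite !mink_lin h !mulr0 scaler_eq0 negb_or alpha0; by split.
have dispE x : displ psi 0 x = psi x - psi 0 by rewrite /displ add0r.
have [||||tau [M [k [k0 phiE Mk]]]] := @additive_null_preserver F hq (displ psi 0).
- by move=> x y; rewrite displD; congr (_ + _); apply: displ_additive.
- by move=> u; apply: displ_null.
- move=> u s hu; have [->|u0] := eqVneq u 0.
    by exists 0; rewrite scaler0 displ0 scale0r.
  exact: displ_dir.
- by move=> u v; apply: dir_nonorthogonal.
(* The similarity factor is s^2 or -s^2; taking s as [alpha] leaves a Lorentz or an anti-Lorentz
   matrix respectively. *)
have [s sE] := sqr_or_Nsqr hq k.
have s0 : s != 0.
  by apply: contra k0 => /eqP s0; case: sE => ->; rewrite s0 expr0n ?oppr0.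
exists s, (psi 0), tau, (s^-1 *: M); split=> //.
- by apply: injF_bij; apply: fmorph_inj.
- case: sE => kE; [left|right] => x y;
    by rewrite -!scalemxAl !mink_lin Mk kE; field.
by move=> r; rewrite -scalemxAl scalerA divff // scale1r -phiE dispE subrK.
Qed.
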